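(* Let $k\ge 2$ be an integer, let $q\ne 2$ be a prime, and let $\mathcal{G}=\langle r,s : s^{2}=r^{2^kq}=e,\ srs^{-1}=r^{2^{k-1}q-1}\rangle$. Then the characteristic polynomial of the adjacency matrix $A$ of the power graph $P(\mathcal{G})$ is $$Char(A,x)=x^{2^{k-1}q-1}(x-1)^{2^{k-2}q-1}(x+1)^{5\cdot 2^{k-2}q-2k-2}\,Char(\mathcal{Q},x),$$ where $Char(\mathcal{Q},x)=\det(xI-\mathcal{Q})$ and $\mathcal{Q}$ is the $(2k+4)\times(2k+4)$ matrix with block form $$\mathcal{Q}=\begin{bmatrix} A_1 & R & A_2\\ B^T & M & O\\ A_3 & O & A_4\end{bmatrix}$$ (block sizes $2,2k,2$), defined as follows. Let $(d_1,\ldots,d_{2k})=(2^kq,2^{k-1}q,\ldots,2^2q,2q,\;q,\;2^2,2^3,\ldots,2^k)$, so that $d_{k+1}=q$. Then $$A_1=\begin{bmatrix}0&1\\1&0\end{bmatrix},\quad A_2=\begin{bmatrix}2^{k-1}q&2^{k-1}q\\2^{k-1}q&0\end{bmatrix},\quad A_3=\begin{bmatrix}1&1\\1&0\end{bmatrix},\quad A_4=\begin{bmatrix}1&0\\0&0\end{bmatrix};$$ $B$ is the $2\times 2k$ matrix all of whose entries are $1$ except the $(2,k+1)$ entry, which is $0$; $R$ is the $2\times 2k$ matrix with $R_{1j}=\phi(d_j)$ for all $j$, $R_{2j}=\phi(d_j)$ for $j\ne k+1$, and $R_{2,k+1}=0$; $M$ is the $2k\times 2k$ matrix with $M_{ii}=\phi(d_i)-1$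 and, for $i\neq j$, $M_{ij}=\phi(d_j)$ if $d_i\mid d_j$ or $d_j\mid d_i$, and $M_{ij}=0$ otherwise; the blocks $O$ are zero matrices.
   Context: The power graph $P(\Omega)$ of a group $\Omega$ is the simple graph with vertex set $\Omega$ in which two distinct elements $u,v$ are adjacent iff $u=v^m$ or $v=u^n$ for some positive integers $m,n$. $\phi$ is Euler's totient function. The matrix $\mathcal{Q}$ is the quotient matrix of $A$ for the equitable partition of $\mathcal{G}$ into: $\{e\}$; $\{r^{2^{k-1}q}\}$; for each $j=1,\dots,2k$, the elements of $\langle r\rangle$ of order $d_j$; $\{sr^{2j+1}:0\le j\le 2^{k-1}q-1\}$; $\{sr^{2t}:1\le t\le 2^{k-1}q\}$. *)

(* Defs.v *)
From mathcomp Require Import all_boot all_order all_algebra all_fingroup all_solvable.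
From mathcomp Require Import boolp.

Set Implicit Arguments.
Unset Strict Implicit.
Unset Printing Implicit Defensive.

Import GRing.Theory.

Definition power_graph (gT : groupType) : rel gT := fun u v =>
  `[< u <> v /\ ((exists2 m : nat, (0 < m)%N & u = (v ^+ m)%g) \/
                 (exists2 n : nat, (0 < n)%N & v = (u ^+ n)%g)) >].

Local Open Scope ring_scope.

(* Adjacency matrix of the subgraph of e induced on V, whose vertices are
   listed in the order given by enum_val. *)
Definition adjacency_mx (R : nzRingType) (T : finType) (V : {set T})
    (e : rel T) : 'M[R]_#|V| :=
  \matrix_(i, j) (e (enum_val i) (enum_val j))%:R.

Section QuotientMatrix.

Variables (R : nzRingType) (k q : nat).

(* All indices start from 0, so dQ j is d_(j+1) in
     (d_1, ..., d_2k) = (2^k q, 2^(k-1) q, ..., 2 q, q, 2^2, 2^3, ..., 2^k);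
   in particular d_(k+1) = q is dQ k. *)
Definition dQ (j : nat) : nat :=
  if (j < k)%N then (2 ^ (k - j) * q)%N
  else if j == k then q
  else (2 ^ (j - k).+1)%N.

Definition mx2 (a b c d : R) : 'M[R]_2 :=
  \matrix_(i, j) if i == 0 then (if j == 0 then a else b)
                 else (if j == 0 then c else d).

Definition A1 : 'M[R]_2 := mx2 0 1
                               1 0.

Definition A2 : 'M[R]_2 := mx2 (2 ^ (k - 1) * q)%:R (2 ^ (k - 1) * q)%:R
                               (2 ^ (k - 1) * q)%:R 0.

Definition A3 : 'M[R]_2 := mx2 1 1
                               1 0.

Definition A4 : 'M[R]_2 := mx2 1 0
                               0 0.

Definition BQ : 'M[R]_(2, 2 * k) :=
  \matrix_(i, j) if (i == 1) && (val j == k) then 0 else 1.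

Definition RQ : 'M[R]_(2, 2 * k) :=
  \matrix_(i, j) if (i == 1) && (val j == k) then 0 else (totient (dQ j))%:R.

Definition MQ : 'M[R]_(2 * k) :=
  \matrix_(i, j)
    if i == j then (totient (dQ i))%:R - 1
    else if (dQ i %| dQ j)%N || (dQ j %| dQ i)%N then (totient (dQ j))%:R
    else 0.

(*         [ A1   R   A2 ]
           [ B^T  M   0  ]
           [ A3   0   A4 ]   with blocks of sizes 2, 2k and 2. *)
Definition Qmx : 'M[R]_(2 + 2 * k + 2) :=
  block_mx (block_mx A1 RQ BQ^T MQ) (col_mx A2 0)
           (row_mx A3 0)            A4.

End QuotientMatrix.

(* Main.v *)
Require Import Defs.
From mathcomp Require Import all_boot all_order all_algebra all_fingroup all_solvable.
From mathcomp Require Import boolp zify ring.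

Set Implicit Arguments.
Unset Strict Implicit.
Unset Printing Implicit Defensive.

Import GRing.Theory.

(** Write n = 2^k q and h = n / 2, an even number.  The group consists of the
    cyclic group <r> of order n and of a coset of h elements of order 4, with
    square r^h, and h involutions.  Group the elements into cells according to
    membership in <r> and order.  Whether two elements are adjacent depends
    only on their cells, up to a local correction: elements of <r> of equal
    order form a clique, elements of order 4 outside <r> are matched with their
    inverses, and outer involutions are pairwise non-adjacent.  Hence the
    adjacency matrix is A = D + U W, where U is the indicator matrix of the
    cells, W records the adjacency of cells with elements, and D is the local
    correction ([power_graph_local_cell], [adjacency_mxE]).

    The columns of U are eigenvectors of D, D U = U L with L diagonal, and
    L + W U is the quotient matrix Q ([local_mx_cells], [Qmx_cells]).  The
    identity Char(D + U W) Char(L) = Char(D) Char(L + W U)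
    ([char_poly_intertwine]), which evaluates one block determinant in two
    ways, then reduces the theorem to Char(L) and Char(D).  L has entries -1 on
    the 2k + 2 cells of <r>, and 1 and 0 on the two outer cells.  For D, the
    only non-diagonal part is the perfect matching, which the same identity
    handles with the pairs {x, x^-1} as cells ([char_poly_local_mx]).  All
    cancelled factors are monic.

    That <r> really has order n and index 2 follows by comparing the presented
    group with a semidirect product ([isoGrp_order2_extension]); the cells of
    <r> are matched with the indices of Q by listing the divisors of 2^k q. *)

(** * A characteristic polynomial identity for equitable partitions *)

Section CharPoly.
Local Open Scope ring_scope.
Variable R : comNzRingType.

(** Both sides are the determinant of the block matrix with diagonal blocks
    X - D and X - L and off-diagonal blocks (X - D) U = U (X - L) and W:
    clearing the upper right block with rows uses the second form of that
    block and produces X - (D + U W), clearing it with columns uses the first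
    and produces X - (L + W U).  Taking U to be the indicator matrix of the
    cells of an equitable partition, L + W U is its quotient matrix. *)
Lemma char_poly_intertwine n m (D : 'M[R]_n) (U : 'M_(n, m)) (W : 'M_(m, n))
    (L : 'M_m) :
  D *m U = U *m L ->
  char_poly (D + U *m W) * char_poly L = char_poly D * char_poly (L + W *m U).
Proof.
move=> DU; rewrite /char_poly /char_poly_mx !map_mxD !map_mxM /=.
set D' := map_mx _ D; set U' := map_mx _ U; set W' := map_mx _ W.
set L' := map_mx _ L; set x := 'X.
have DU' : D' *m U' = U' *m L' by rewrite -!map_mxM DU.
pose K := block_mx (x%:M - D') ((x%:M - D') *m U') W' (x%:M - L').
have detE (V : 'M[{poly R}]_(n, m)) : \det (block_mx 1%:M V 0 1%:M) = 1.
  by rewrite det_ublock !det1 mulr1.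
transitivity (\det K).
  rewrite -[RHS]mul1r -(detE (- U')) -det_mulmx mulmx_block.
  rewrite !mul1mx !mul0mx !add0r mulNmx mulmxBr mulmxBl DU'.
  rewrite mul_mx_scalar mul_scalar_mx.
  by rewrite scalerN mulNmx -opprD subrr det_lblock opprD addrA.
rewrite -[LHS]mulr1 -[X in _ * X = _](detE (- U')) -det_mulmx mulmx_block.
rewrite !mulmx1 !mulmx0 !addr0 !mulmxN addNr det_lblock.
by rewrite [- _ + _]addrC opprD addrA.
Qed.

Lemma char_poly_diag n (d : 'rV[R]_n) :
  char_poly (diag_mx d) = \prod_i ('X - (d 0 i)%:P).
Proof.
rewrite char_poly_trig; first by apply: eq_bigr => i _; rewrite mxE eqxx.
exact/is_diag_mx_is_trig/diag_mx_is_diag.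
Qed.

Lemma char_poly_scalar n (a : R) :
  char_poly (a%:M : 'M_n) = ('X - a%:P) ^+ n.
Proof.
rewrite -diag_const_mx char_poly_diag; under eq_bigr do rewrite mxE.
by rewrite prodr_const card_ord.
Qed.

End CharPoly.

(** * The presented group *)

Section PresentedGroup.
Local Open Scope group_scope.

(** The semidirect product of a cyclic group of order n by one of order 2 is a
    model of the presentation, which shows that the presented group does not
    collapse; the congruence says that r |-> r^e is an automorphism of order
    dividing 2. *)
Lemma order2_extension_exists n e : (1 < n)%N -> (e * e = 1 %[mod n])%N ->
  exists gT : finGroupType, exists2 G : {group gT}, #|G| = (2 * n)%N &
    G \homg Grp (r : s : s ^+ 2 = r ^+ n = 1, s * r * s^-1 = r ^+ e).
Proof.
move=> n_gt1 ee1; exists (Extremal.gtype n 2 e); exists [set: _]%G.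
  by rewrite Extremal.card.
have e_unit : (e%:R : 'Z_#[Zp1 : 'Z_n])%R \is a GRing.unit.
  apply/GRing.unitrP; exists (e%:R)%R; rewrite -GRing.natrM.
  by split; apply: val_inj; rewrite /= !Zp_nat /= order_Zp1 !Zp_cast ?Zp_cast.
pose u := FinRing.unit _ e_unit.
have /isoGrp_hom/existsP[[x y]] :
    [set: Extremal.gtype n 2 e]%G
      \isog Grp (x : y : x ^+ n, y ^+ 2, x ^ y = x ^+ e).
  apply: Extremal.Grp => //; exists (Zp_unitm u).
  rewrite Aut_aut order_injm ?injm_Zp_unitm ?in_setT //; split=> //.
    rewrite order_dvdn -val_eqE /= -GRing.natrM.
    by rewrite -val_eqE /= !Zp_nat /= order_Zp1 !Zp_cast ?Zp_cast ?ee1.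
  apply/eqP; rewrite autE ?cycle_id // eq_expg_mod_order /=.
  by rewrite Zp_nat /= order_Zp1 !Zp_cast ?Zp_cast // modn_mod.
rewrite /= !xpair_eqE => /and4P[/eqP defG /eqP xn1 /eqP y21 /eqP xy].
apply/existsP; exists (x, y); rewrite /= !xpair_eqE defG xn1 y21 !eqxx /=.
have yV : y^-1 = y by apply/eqP; rewrite eq_invg_mul -y21 expgS.
by rewrite -xy conjgE yV mulgA.
Qed.

(** The relations bound the order of G by 2n from above; G maps onto the model
    of the preceding lemma, which bounds it by 2n from below.  Hence every
    inequality along the way is an equality. *)
Lemma isoGrp_order2_extension (gT : finGroupType) (G : {group gT}) n e :
    (1 < n)%N -> (e * e = 1 %[mod n])%N ->
    G \isog Grp (r : s : s ^+ 2 = r ^+ n = 1, s * r * s^-1 = r ^+ e) ->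
  exists r s, [/\ <[r]> * <[s]> = G, #[r] = n, s ^+ 2 = 1,
    s * r * s^-1 = r ^+ e & #|G| = (2 * n)%N].
Proof.
move=> n_gt1 ee1 isoG.
have [hT [H oH homH]] := order2_extension_exists n_gt1 ee1.
have /existsP[[r s]] := isoGrp_hom isoG.
rewrite /= !xpair_eqE => /and4P[/eqP defG /eqP s21 /eqP rn1 /eqP rel_sr].
have sV : s^-1 = s by apply/eqP; rewrite eq_invg_mul -s21 expgS.
have defG' : <[r]> * <[s]> = G.
  rewrite -norm_joinEr // norms_cycle.
  by rewrite conjgE sV -{2}sV mulgA rel_sr mem_cycle.
have leG : (#|G| <= #[r] * #[s])%N.
  by rewrite -defG' mul_cardG leq_pmulr // cardG_gt0.
have ler : (#[r] <= n)%N by rewrite dvdn_leq ?order_dvdn ?rn1 // ltnW.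
have les : (#[s] <= 2)%N by rewrite dvdn_leq ?order_dvdn ?s21.
have geG : (2 * n <= #|G|)%N.
  by rewrite -oH dvdn_leq ?cardG_gt0 // card_homg // isoG.
have le2 : (#[r] * #[s] <= #[r] * 2)%N by rewrite leq_mul2l les orbT.
have or : #[r] = n by lia.
exists r, s; split=> //; apply/eqP; rewrite eqn_leq geG mulnC.
by rewrite (leq_trans leG) // (leq_trans le2) // or.
Qed.

End PresentedGroup.

(** * Elements outside the cyclic subgroup *)

Section OuterCoset.
Local Open Scope group_scope.

Variables (gT : finGroupType) (G : {group gT}) (h : nat) (r s : gT).
Hypotheses (h_gt0 : (0 < h)%N) (h_even : ~~ odd h).
Hypotheses (defG : <[r]> * <[s]> = G) (or : #[r] = h.*2) (s21 : s ^+ 2 = 1).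
Hypotheses (rel_sr : s * r * s^-1 = r ^+ (h - 1)) (oG : #|G| = (2 * h.*2)%N).

Local Notation C := <[r]>.
Local Notation O := [set x in G | (x \notin C) && (#[x] == 4)].
Local Notation E := [set x in G | (x \notin C) && (#[x] == 2)].

Lemma rot_half_sqr : (r ^+ h) ^+ 2 = 1.
Proof. by rewrite -expgM muln2 -or expg_order. Qed.

Lemma rot_half_neq1 : r ^+ h != 1.
Proof. by rewrite -order_dvdn or; apply/negP => /dvdn_leq; lia. Qed.

Lemma cycle_sub_G : C \subset G.
Proof. by rewrite -defG mulG_subl. Qed.

(** Since s inverts r up to the factor r^h, we have
    (r^i s)^2 = r^i r^((h - 1) i) = r^(h i). *)
Lemma outer_sqr x : x \in G -> x \notin C ->
  exists i, x = r ^+ i * s /\ x ^+ 2 = (r ^+ h) ^+ i.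
Proof.
rewrite -{1}defG => /mulsgP[_ _ /cycleP[i ->] /cycleP[j ->] ->].
have sV : s^-1 = s by apply/eqP; rewrite eq_invg_mul -s21 expgS.
(* An even exponent of s would put x in the cyclic subgroup. *)
have -> : s ^+ j = s ^+ odd j.
  by rewrite -{1}[j]odd_double_half expgD -muln2 mulnC expgM s21 expg1n mulg1.
case: (odd j); last by rewrite expg0 mulg1 mem_cycle.
rewrite expg1 => _; exists i; split=> //.
have srs : s * r ^+ i * s = (r ^+ (h - 1)) ^+ i.
  rewrite -rel_sr; elim: i => [|i IHi]; first by rewrite expg0 mulg1 -expg2.
  by rewrite [in RHS]expgS -IHi expgS sV !mulgA -(mulgA _ s s) -expg2 s21 mulg1.
rewrite expg2 -[LHS]mulgA (mulgA s) srs -!expgM -expgD; congr (_ ^+ _).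
by case: (h) h_gt0 => // h' _; rewrite subn1 mulSn.
Qed.

Lemma outer_sqr_1z x : x \in G -> x \notin C -> x ^+ 2 = 1 \/ x ^+ 2 = r ^+ h.
Proof.
move=> Gx Cx; have [i [_ ->]] := outer_sqr Gx Cx.
rewrite -[i]odd_double_half expgD -mul2n expgM rot_half_sqr expg1n mulg1.
by case: (odd i); [right | left].
Qed.

Lemma outer_expg4 x : x \in G -> x \notin C -> x ^+ 4 = 1.
Proof.
move=> Gx Cx; rewrite (expgM x 2 2).
by case: (outer_sqr_1z Gx Cx) => ->; rewrite ?rot_half_sqr ?expg1n.
Qed.

Lemma outer_order x : x \in G -> x \notin C ->
  #[x] = if x ^+ 2 == 1 then 2%N else 4%N.
Proof.
move=> Gx Cx; have x1 : x != 1 by apply: contraNneq Cx => ->; apply: group1.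
have [x21|x2] := eqVneq (x ^+ 2) 1; first exact: nt_prime_order.
have := outer_expg4 Gx Cx; move: x2 x1; rewrite -order_dvdn -order_eq1.
move=> x2 x1 /eqP; rewrite -order_dvdn dvdn_divisors //.
by rewrite !inE => /or3P[] /eqP xo; rewrite xo in x1 x2 *.
Qed.

(** For x outside C := <r>, the odd powers of x stay outside C because x^2 is
    in C, so that C meets <x> in <x^2>; inside the cyclic group C membership in
    a cyclic subgroup is divisibility of orders. *)
Lemma cycle_outer_inner x y : x \in G -> x \notin C -> y \in C ->
  (y \in <[x]>) = (#[y] %| #[x] %/ 2)%N.
Proof.
move=> Gx Cx Cy.
have Cx2 : x ^+ 2 \in C.
  by case: (outer_sqr_1z Gx Cx) => ->; rewrite ?group1 ?mem_cycle.
have -> : (#[x] %/ 2)%N = #[x ^+ 2].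
  by rewrite orderXdiv // outer_order //; case: ifP.
rewrite (cardSg_cyclic (cycle_cyclic r)) ?cycle_subG //.
apply/idP/idP => [/cycleP[i yi]|]; last by apply/subsetP; apply: cycleX.
move: Cy; rewrite yi -[i]odd_double_half expgD -mul2n expgM.
case: (odd i) => /=; last by rewrite expg0 mul1g mem_cycle.
by rewrite expg1 (groupMr _ (groupX _ Cx2)) (negPf Cx).
Qed.

Lemma cycle_outer_outer x y : x \in G -> x \notin C -> y \notin C ->
  (y \in <[x]>) = (y == x) || (y == x^-1).
Proof.
move=> Gx Cx Cy; have x4 := outer_expg4 Gx Cx.
apply/idP/orP => [/cycleP[i yi]|]; last first.
  by case=> /eqP->; rewrite ?groupV cycle_id.
have Cx2 : x ^+ 2 \in C.
  by case: (outer_sqr_1z Gx Cx) => ->; rewrite ?group1 ?mem_cycle.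
have : y = x ^+ (i %% 4) by rewrite yi expg_mod.
have : (i %% 4 < 4)%N by rewrite ltn_mod.
case: (i %% 4)%N => [|[|[|[|]]]] // _ y_eq; rewrite y_eq ?expg1 ?eqxx.
- by rewrite y_eq group1 in Cy.
- by left.
- by rewrite y_eq Cx2 in Cy.
by right; rewrite eq_sym eq_invg_mul -expgS x4.
Qed.

Lemma mem_mulr_outer x : x \in G -> x \notin C ->
  (r * x \in G) && (r * x \notin C).
Proof.
move=> Gx Cx; have rC := cycle_id r.
by rewrite (groupMl _ rC) Cx groupM // (subsetP cycle_sub_G).
Qed.

Lemma mulr_outer_sqr x : x \in G -> x \notin C ->
  (r * x) ^+ 2 = r ^+ h * x ^+ 2.
Proof.
move=> Gx Cx; have [i [xE ->]] := outer_sqr Gx Cx.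
have /andP[Grx Crx] := mem_mulr_outer Gx Cx.
have [j [+ ->]] := outer_sqr Grx Crx.
rewrite {1}xE mulgA -expgS => /mulIg/eqP; rewrite eq_expg_mod_order or => ij.
rewrite -expgS; apply/eqP; rewrite eq_expg_mod_order eq_sym.
have h2 : (#[r ^+ h] = 2)%N.
  by apply: nt_prime_order; [|apply: rot_half_sqr|apply: rot_half_neq1].
have d2 : (2 %| h.*2)%N by rewrite dvdn2 odd_double.
by rewrite h2 -(modn_dvdm i.+1 d2) (eqP ij) modn_dvdm.
Qed.

(** Left multiplication by r exchanges the elements of order 2 and of order 4
    outside <r>, as it multiplies the square of such an element by r^h. *)
Lemma card_outer24 : #|O| = #|E|.
Proof.
have shift x : x \in G -> x \notin C ->
    (#[r * x] == 4%N) = (#[x] == 2%N) /\ (#[r * x] == 2%N) = (#[x] == 4%N).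
  move=> Gx Cx; have /andP[Grx Crx] := mem_mulr_outer Gx Cx.
  rewrite !outer_order // mulr_outer_sqr //.
  have rr : r ^+ h * r ^+ h == 1 by rewrite -expg2 rot_half_sqr.
  case: (outer_sqr_1z Gx Cx) => ->.
    by rewrite mulg1 eqxx (negPf rot_half_neq1).
  by rewrite rr (negPf rot_half_neq1).
apply/eqP; rewrite eqn_leq -{1}(card_imset O (mulgI r)).
rewrite -{2}(card_imset E (mulgI r)).
apply/andP; split; apply: subset_leq_card; apply/subsetP => _ /imsetP[x + ->];
rewrite !inE => /and3P[Gx Cx xo]; have /andP[-> ->] := mem_mulr_outer Gx Cx;
by have [e4 e2] := shift x Gx Cx; rewrite ?e4 ?e2.
Qed.

Lemma card_outer : #|O| = h /\ #|E| = h.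
Proof.
suff : (#|O| + #|E| = h.*2)%N by rewrite card_outer24; lia.
have <- : #|G :\: C| = h.*2.
  by rewrite cardsD (setIidPr cycle_sub_G) oG -orderE or; lia.
rewrite -(cardsID O (G :\: C)); congr (_ + _)%N; apply: eq_card => x.
  by rewrite !inE; case: (x \in G); case: (x \in C).
rewrite !inE; case Gx: (x \in G); case Cx: (x \in C) => //=.
by rewrite outer_order ?Cx //; case: ifP.
Qed.

End OuterCoset.

(** * Power graphs and orders in cyclic groups *)

(** In a finite group positive powers already give all of a cyclic
    subgroup. *)
Lemma power_graphE (gT : finGroupType) (x y : gT) :
  power_graph x y = (x != y) && ((x \in <[y]>) || (y \in <[x]>))%g.
Proof.
have powP (u v : gT) :
    (exists2 m, (0 < m)%N & u = (v ^+ m)%g) <-> u \in <[v]>%g.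
  split=> [[m _ ->]|/cycleP[i ->]]; first exact: mem_cycle.
  exists (i + #[v]%g)%N; first by rewrite addn_gt0 order_gt0 orbT.
  by rewrite expgD expg_order mulg1.
apply/asboolP/andP => [[/eqP xy H]|[/eqP xy H]]; split=> //.
  by apply/orP; case: H => /powP; [left | right].
by case/orP: H => /powP; [left | right].
Qed.

Lemma card_cycle_order (gT : finGroupType) (r : gT) d : (d %| #[r])%g ->
  #|[set x in <[r]>%g | #[x]%g == d]| = totient d.
Proof.
move=> d_r; pose a := (r ^+ (#[r] %/ d))%g.
have da : #[a]%g = d.
  rewrite orderXdiv ?dvdn_div //; first by rewrite divnA // mulKn // order_gt0.
rewrite -da totient_gen; apply: eq_card => x; rewrite !inE /generator.
have aC : (<[a]> \subset <[r]>)%g by rewrite cycleX.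
apply/andP/eqP => [[xC /eqP ox]|ax]; last first.
  have xC : x \in <[r]>%g by rewrite (subsetP aC) // ax cycle_id.
  by rewrite /order ax.
apply/eqP; rewrite (eq_subG_cyclic (cycle_cyclic r)) ?cycle_subG ?mem_cycle //.
by rewrite -!orderE ox.
Qed.

(** * Divisors of 2^k q and the index set of the quotient matrix *)

Lemma half_order_double k q : (1 < k)%N ->
  ((2 ^ (k - 1) * q).*2 = 2 ^ k * q)%N.
Proof. by move=> hk; rewrite -mul2n mulnA -expnS subn1 prednK // ltnW. Qed.

Lemma half_order_gt0 k q : prime q -> (0 < 2 ^ (k - 1) * q)%N.
Proof. by move=> pq; rewrite muln_gt0 expn_gt0 (prime_gt0 pq). Qed.

Lemma half_order_even k q : (1 < k)%N -> ~~ odd (2 ^ (k - 1) * q).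
Proof. by move=> hk; rewrite oddM oddX orbF subn_eq0 leqNgt hk. Qed.

(** With h = 2a, (h - 1)^2 = (a - 1) 2h + 1: the action of s on <r> is an
    involution. *)
Lemma sqr_pred_mod_double h : (0 < h)%N -> ~~ odd h ->
  ((h - 1) * (h - 1) = 1 %[mod h.*2])%N.
Proof.
move=> h_gt0 h_even; have hE := even_halfK h_even.
have -> : ((h - 1) * (h - 1) = (h./2 - 1) * h.*2 + 1)%N.
  by rewrite -{1 2 4}hE; nia.
by rewrite modnMDl.
Qed.

Section OrderClasses.
Variables k q : nat.
Hypotheses (hk : 2 <= k) (pq : prime q) (q2 : q != 2).

Lemma coprime2q a : coprime (2 ^ a) q.
Proof. by rewrite coprimeXl // prime_coprime // dvdn_prime2 // eq_sym. Qed.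

Lemma pow2q_inj a b a' b' :
  2 ^ a * q ^ b = 2 ^ a' * q ^ b' -> a = a' /\ b = b'.
Proof.
move=> E; have q0 := prime_gt0 pq.
have lq p c d : prime p -> logn p (2 ^ c * q ^ d) = c * (p == 2) + d * (p == q).
  by move=> pp; rewrite lognM ?expn_gt0 ?q0 // !lognX !logn_prime //.
have := lq 2 a b isT; have := lq q a b pq.
by rewrite E !lq // !eqxx [2 == q]eq_sym (negPf q2); lia.
Qed.

Lemma dvdn_pow2q d : d %| 2 ^ k * q ->
  exists a b, [/\ a <= k, b <= 1 & d = 2 ^ a * q ^ b].
Proof.
move=> dn.
have /dvdn_pfactor : gcdn d (2 ^ k) %| 2 ^ k by apply: dvdn_gcdr.
case=> // a ak da.
have /dvdn_pfactor : gcdn d q %| q ^ 1 by rewrite expn1 dvdn_gcdr.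
case=> // b b1 db; exists a, b; split=> //; rewrite -da -db.
apply/eqP; rewrite eqn_dvd Gauss_dvd; last first.
  rewrite da db; case: (b) => [|c]; rewrite ?coprimen1 //.
  by rewrite coprime_pexpr ?coprime2q.
rewrite !dvdn_gcdl andbT muln_gcdr dvdn_gcd dvdn_mull //=.
by rewrite muln_gcdl dvdn_gcd dn dvdn_mulr.
Qed.

Definition exp2_dQ j := if j <= k then k - j else (j - k).+1.

Lemma dQE j : dQ k q j = 2 ^ exp2_dQ j * q ^ (j <= k).
Proof.
rewrite /dQ /exp2_dQ; case: ltngtP => [jk|jk|->]; rewrite ?expn1 ?muln1 //.
by rewrite subnn mul1n.
Qed.

Lemma dQ_dvd j : j < 2 * k -> dQ k q j %| 2 ^ k * q.
Proof.
move=> j2k; rewrite dQE dvdn_mul //.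
  by rewrite dvdn_exp2l // /exp2_dQ; case: (leqP j k); lia.
by case: (j <= k).
Qed.

Lemma dQ_gt2 j : 2 < dQ k q j.
Proof.
have q_gt2 : 2 < q by rewrite ltn_neqAle eq_sym q2 prime_gt1.
rewrite dQE /exp2_dQ; case: (leqP j k) => jk /=.
  by rewrite expn1 (leq_trans q_gt2) // leq_pmull // expn_gt0.
by rewrite muln1 (@leq_trans (2 ^ 2)) // leq_exp2l // ltnS subn_gt0.
Qed.

Lemma dQ_even j : (2 %| dQ k q j) = (j != k).
Proof.
rewrite dvdn2 dQE oddM !oddX /exp2_dQ orbF.
have -> : odd q by case: (even_prime pq) q2 => [->|].
rewrite orbT andbT; case: (ltngtP j k) => [jk|//|->]; last by rewrite subnn.
by rewrite subn_eq0 leqNgt jk.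
Qed.

(** A cell of the partition is determined by whether it lies in <r> and by the
    common order of its elements.  This is that pair for each index of the
    quotient matrix: orders 1 and 2, then the orders of the list, and finally
    the elements of order 4 (the s r^(2j+1)) and 2 (the s r^(2t)) outside
    <r>. *)
Definition index_code (c : 'I_(2 + 2 * k + 2)) : bool * nat :=
  match split c with
  | inl c' => match split c' with
              | inl i => (true, i.+1)
              | inr j => (true, dQ k q j)
              end
  | inr i => (false, if i == 0 :> nat then 4 else 2)
  end.

Lemma index_code_unit (i : 'I_2) :
  index_code (lshift 2 (lshift (2 * k) i)) = (true, i.+1).
Proof. by rewrite /index_code (unsplitK (inl _)) (unsplitK (inl _)). Qed.

Lemma index_code_dQ (j : 'I_(2 * k)) :
  index_code (lshift 2 (rshift 2 j)) = (true, dQ k q j).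
Proof. by rewrite /index_code (unsplitK (inl _)) (unsplitK (inr _)). Qed.

Lemma index_code_outer (i : 'I_2) :
  index_code (rshift (2 + 2 * k) i) = (false, if i == 0 :> nat then 4 else 2).
Proof. by rewrite /index_code (unsplitK (inr _)). Qed.

Definition index_codeE := (index_code_unit, index_code_dQ, index_code_outer).

Lemma index_caseP (P : 'I_(2 + 2 * k + 2) -> Prop) :
  (forall i, P (lshift 2 (lshift (2 * k) i))) ->
  (forall j, P (lshift 2 (rshift 2 j))) ->
  (forall i, P (rshift (2 + 2 * k) i)) -> forall c, P c.
Proof.
move=> P1 P2 P3 c; case: (split_ordP c) => [c' ->|i ->] //.
by case: (split_ordP c') => i ->.
Qed.

(** Exponents (0, 0) and (1, 0) are the two singleton cells; for the others the
    position in the list is k - a when q divides the order and k + a - 1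
    otherwise. *)
Lemma index_code_innerP a b : a <= k -> b <= 1 ->
  exists c, index_code c = (true, 2 ^ a * q ^ b).
Proof.
case: b => [|[|//]] ak _; last first.
  have jlt : k - a < 2 * k by lia.
  exists (lshift 2 (rshift 2 (Ordinal jlt))).
  rewrite index_codeE dQE /exp2_dQ /=.
  by rewrite leq_subr subKn.
case: a ak => [|[|a]] ak.
- by exists (lshift 2 (lshift (2 * k) ord0)); rewrite index_codeE.
- by exists (lshift 2 (lshift (2 * k) ord_max)); rewrite index_codeE.
have jlt : k + a.+1 < 2 * k by lia.
exists (lshift 2 (rshift 2 (Ordinal jlt))); rewrite index_codeE dQE /exp2_dQ /=.
by rewrite leqNgt -[X in X < _]addn0 ltn_add2l /= addKn.
Qed.

Lemma index_code_inj : injective index_code.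
Proof.
have dQn j (i : 'I_2) : dQ k q j <> i.+1.
  have -> : i.+1 = 2 ^ i * q ^ 0 by case: i => [[|[|]]].
  rewrite dQE => /pow2q_inj[]; rewrite /exp2_dQ.
  by case: leqP => // jk; have := ltn_ord i; lia.
elim/index_caseP=> i; elim/index_caseP=> j; rewrite !index_codeE // => [] [].
- by move/val_inj->.
- by move/esym/dQn.
- by move/dQn.
- rewrite !dQE => /pow2q_inj[ea eb]; do 2!congr (_ _ _); apply: val_inj => /=.
  by move: ea eb; rewrite /exp2_dQ; case: (leqP i k); case: (leqP j k); lia.
by case: i j => [[|[|]] //= ?] [[|[|]] //= ?] => // _; congr rshift;
  apply: val_inj.
Qed.

Lemma index_code_inner_dvd c :
  (index_code c).1 -> (index_code c).2 %| 2 ^ k * q.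
Proof.
elim/index_caseP: c => i; rewrite index_codeE //= => _; last exact: dQ_dvd.
case: i => [[|[|]]] //= _.
by rewrite dvdn_mulr // dvdn_exp // (leq_trans _ hk).
Qed.

End OrderClasses.

(** * The local part of the adjacency matrix *)

Lemma sum_bool_card (R : nzRingType) (T : finType) (A : {set T}) (P : pred T) :
  (\sum_(x in A) (P x)%:R = #|[set x in A | P x]|%:R :> R)%R.
Proof.
rewrite -sum1_card natr_sum big_mkcond [RHS]big_mkcond /=.
by apply: eq_bigr => x _; rewrite inE; case: (x \in A); case: (P x).
Qed.

Section LocalPart.
Local Open Scope ring_scope.
Variables (R : comNzRingType) (gT : finGroupType) (G C : {group gT}).

(** In the application C = <r>; for m = 4 and m = 2 these are the two cells
    outside <r>. *)
Definition outer (m : nat) : {set gT} :=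
  [set x in G | (x \notin C) && (#[x]%g == m)].

Hypotheses (sCG : C \subset G).
Hypothesis o24 : forall x, x \in G -> x \notin C ->
  #[x]%g = 2%N \/ #[x]%g = 4%N.

(** The adjacency entry minus the constant that the two cells prescribe.
    Elements of C of equal order form a clique; prescribing the constant 1
    there adds loops, whence the diagonal entries -1.  Outside C the prescribed
    constant is 0 and the edges join an element to its inverse. *)
Definition local_adj (x y : gT) : R :=
  if x \in C then - (x == y)%:R else ((x != y) && (y == x^-1)%g)%:R.

Definition local_mx : 'M[R]_#|G| :=
  \matrix_(i, j) local_adj (enum_val i) (enum_val j).

Let pairV (x : gT) : {set gT} := [set x; x^-1%g].
Let pairs : {set {set gT}} := pairV @: outer 4.

Lemma outer4_invK x : x \in outer 4 -> x != x^-1%g.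
Proof.
rewrite inE => /and3P[_ _ /eqP ox]; rewrite eq_sym eq_invg_mul -expg2.
by rewrite -order_dvdn ox.
Qed.

Lemma mem_pair p y :
  p \in pairs -> (y \in p) = (y \in outer 4) && (p == pairV y).
Proof.
case/imsetP=> x Ox ->; apply/idP/andP => [|[_ /eqP->]]; last exact: set21.
case/set2P=> ->; first by rewrite Ox.
by move: Ox; rewrite !inE !groupV orderV /pairV invgK setUC => ->.
Qed.

Lemma card_pair p : p \in pairs -> #|p| = 2%N.
Proof. by case/imsetP=> x Ox ->; rewrite cards2 outer4_invK. Qed.

Lemma card_pairs : (2 * #|pairs|)%N = #|outer 4|.
Proof.
rewrite -[RHS]sum1_card (partition_big_imset pairV) /= mulnC -sum_nat_const.
apply: eq_bigr => p Pp; rewrite -[LHS](card_pair Pp) sum1dep_card.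
by apply: eq_card => y; rewrite inE mem_pair // eq_sym.
Qed.

Lemma sum_pairs x y :
  \sum_(p in pairs) ((x \in p) && (y \in p))%:R
    = ((x \in outer 4) && (y \in pairV x))%:R :> R.
Proof.
have [Ox|Ox] := boolP (x \in outer 4); last first.
  by rewrite big1 // => p Pp; rewrite mem_pair // (negPf Ox).
rewrite (bigD1 (pairV x)) ?imset_f //= set21 big1 ?addr0 // => p /andP[Pp].
by rewrite (mem_pair x Pp) => /negPf->; rewrite andbF.
Qed.

Definition local_diag (x : gT) : R := if x \in outer 2 then 0 else - 1.

(** On the elements of order 4 outside C, the local adjacency is that of a
    perfect matching, i.e. -1 plus the sum over the pairs {x, x^-1} of the
    all-one matrix of the pair. *)
Lemma local_adjE x y : x \in G -> y \in G ->
  local_adj x y = local_diag x *+ (x == y)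
    + \sum_(p in pairs) ((x \in p) && (y \in p))%:R.
Proof.
move=> Gx Gy; rewrite sum_pairs /local_adj /local_diag.
have [Cx|Cx] := boolP (x \in C).
  by rewrite !inE Cx !andbF addr0; case: eqP; rewrite ?mulr0n ?oppr0.
have [o2|o4] := o24 Gx Cx.
  have xV : x^-1%g = x by apply/eqP; rewrite eq_invg_mul -expg2 -o2 expg_order.
  by rewrite !inE Gx Cx o2 /= mul0rn addr0 xV eq_sym andNb.
have Ox : x \in outer 4 by rewrite inE Gx Cx o4.
rewrite Ox /= !inE Gx Cx o4 /= [y == x]eq_sym.
case: (eqVneq x y) => [<-|_] /=; last by rewrite mulr0n add0r.
by rewrite mulr1n addNr.
Qed.

(** Apply [char_poly_intertwine] with a diagonal D and the pairs {x, x^-1} as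
    cells: the eigenvalue on the pairs is -1
    before, and -1 + 2 = 1 after adding the pair matrix.  So one factor X + 1
    per pair becomes X - 1. *)
Lemma char_poly_local_mx m : #|outer 4| = (2 * m)%N ->
  char_poly local_mx
    = ('X + 1) ^+ (#|C| + m) * 'X ^+ #|outer 2| * ('X - 1) ^+ m.
Proof.
move=> Op; have mE : m = #|pairs|.
  by apply/eqP; rewrite -(eqn_pmul2l (isT : 0 < 2)%N) card_pairs Op.
rewrite {}mE in Op *.
pose U : 'M[R]_(#|G|, #|pairs|) := \matrix_(i, p)
    (enum_val i \in (enum_val p : {set gT}))%:R.
pose d := \row_(i < #|G|) local_diag (enum_val i).
have DU : diag_mx d *m U = U *m (- 1)%:M.
  apply/matrixP=> i p; rewrite mul_diag_mx mul_mx_scalar !mxE.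
  case: (boolP (_ \in _)) => [|_]; last by rewrite !mulr0.
  rewrite (mem_pair _ (enum_valP p)) /local_diag !inE.
  by case/andP=> /and3P[_ _ /eqP->] _; rewrite !andbF.
have UU : U^T *m U = 2%:R%:M.
  apply/matrixP=> p p'; rewrite !mxE.
  transitivity (\sum_(x in G) ((x \in (enum_val p : {set gT}))
      && (x \in (enum_val p' : {set gT})))%:R : R).
    rewrite [RHS]big_enum_val /=; apply: eq_bigr => i _; rewrite !mxE.
    by rewrite -natrM mulnb.
  rewrite sum_bool_card; have Pp := enum_valP p; have Pp' := enum_valP p'.
  have [<-|pp'] := eqVneq p p'.
    rewrite -(card_pair Pp) mulr1n; congr _%:R; apply: eq_card => x.
    by rewrite inE andbb (mem_pair x Pp) inE; case: (x \in G).
  rewrite mulr0n (_ : [set _ in _ | _] = set0) ?cards0 //.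
  apply/setP=> x; rewrite !inE (mem_pair x Pp) (mem_pair x Pp').
  apply/negP => /and3P[_ /andP[_ /eqP e] /andP[_ /eqP e']].
  by case/eqP: pp'; apply: enum_val_inj; rewrite e e'.
have <- : diag_mx d + U *m U^T = local_mx.
  apply/matrixP=> i j; rewrite !mxE local_adjE ?enum_valP //.
  rewrite (inj_eq enum_val_inj) [in RHS]big_enum_val /=; congr (_ + _).
  by apply: eq_bigr => p _; rewrite !mxE -natrM mulnb.
have := char_poly_intertwine U^T DU; rewrite UU -raddfD /= addKr.
rewrite !char_poly_scalar !polyC1 polyCN opprK => charU.
have regX : GRing.rreg (('X + 1 : {poly R}) ^+ #|pairs|).
  by apply/monic_rreg/monic_exp; rewrite -polyC1 monicXaddC.
apply: regX; rewrite {}charU mulrAC; congr (_ * _).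
rewrite mulrAC -exprD -addnA addnn -mul2n -Op.
rewrite char_poly_diag; under eq_bigr do rewrite mxE.
rewrite -(big_enum_val (A := mem G) (fun x => 'X - (local_diag x)%:P)) /=.
rewrite (bigID (mem (outer 2))) /= mulrC; congr (_ * _).
  rewrite -(@eq_bigl _ _ _ _ _ (mem (C :|: outer 4))) /=; last first.
    move=> x; rewrite !inE; case Gx: (x \in G); last first.
      by rewrite orbF; apply: contraFF Gx; apply: subsetP.
    case Cx: (x \in C) => //=.
    by have [->|->] := o24 Gx (negbT Cx).
  rewrite (eq_bigr (fun=> 'X + 1)); last first.
    move=> x; rewrite /local_diag !inE => /orP[->|/and3P[_ _ /eqP->]];
    by rewrite ?andbF polyCN opprK.
  rewrite prodr_const cardsU (_ : C :&: outer 4 = set0) ?cards0 ?subn0 //.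
  by apply/setP=> x; rewrite !inE; case: (x \in C); rewrite ?andbF.
rewrite (eq_bigl (mem (outer 2))) /=; last first.
  by move=> x; rewrite !inE; case: (x \in G).
rewrite (eq_bigr (fun=> 'X)) ?prodr_const // => x Ex.
by rewrite /local_diag Ex subr0.
Qed.

End LocalPart.

(** * The partition into cells *)

(** Adjacency of cells, on pairs (membership in <r>, order): in <r> comparable
    orders, by cyclicity; across, the inner order divides half the outer one, because
    the part of <x> in <r> is <x^2>; and nothing between outer cells, whose few
    edges are accounted for by [local_adj]. *)
Definition cell_adj (c c' : bool * nat) : bool :=
  match c, c' with
  | (true, d), (true, d') => (d %| d') || (d' %| d)
  | (true, d), (false, m) | (false, m), (true, d) => d %| m %/ 2
  | (false, _), (false, _) => false
  end.

Section Cells.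
Local Open Scope ring_scope.
Variables (R : comNzRingType) (k q : nat).
Hypotheses (hk : (2 <= k)%N) (pq : prime q) (q2 : q != 2%N).
Variables (gT : finGroupType) (G : {group gT}) (r s : gT).
Let h := (2 ^ (k - 1) * q)%N.
Hypotheses (defG : (<[r]> * <[s]>)%g = G) (or : #[r]%g = h.*2).
Hypotheses (s21 : (s ^+ 2)%g = 1%g).
Hypotheses (rel_sr : (s * r * s^-1)%g = (r ^+ (h - 1))%g).
Hypothesis oG : #|G| = (2 * h.*2)%N.

Let C := <[r]>%G.

Let h_double : h.*2 = (2 ^ k * q)%N.
Proof. exact: half_order_double. Qed.

Let h_gt0 : (0 < h)%N.
Proof. exact: half_order_gt0. Qed.

Let h_even : ~~ odd h.
Proof. exact: half_order_even. Qed.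

Let sCG : C \subset G := cycle_sub_G defG.

Let o24 x : x \in G -> x \notin C -> #[x]%g = 2%N \/ #[x]%g = 4%N.
Proof.
by move=> Gx Cx; rewrite (outer_order h_gt0 defG or s21 rel_sr Gx Cx);
  case: ifP; [left | right].
Qed.

Definition cell_code (x : gT) : bool * nat := (x \in <[r]>%g, #[x]%g).

Lemma power_graph_local_cell x y : x \in G -> y \in G ->
  (power_graph x y)%:R
    = local_adj R C x y + (cell_adj (cell_code x) (cell_code y))%:R :> R.
Proof.
have inner u v : u \in C -> v \in C -> (u \in <[v]>%g) = (#[u]%g %| #[v]%g)%N.
  by move=> Cu Cv; rewrite (cardSg_cyclic (cycle_cyclic r)) ?cycle_subG.
have inner_outer u v : v \in G -> u \in C -> v \notin C ->
    (u != v) && ((u \in <[v]>) || (v \in <[u]>))%g = (#[u]%g %| #[v]%g %/ 2)%N.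
  move=> Gv Cu Cv.
  rewrite -(cycle_outer_inner h_gt0 defG or s21 rel_sr Gv Cv Cu).
  have -> : (v \in <[u]>%g) = false.
    by apply: contraNF Cv; apply: subsetP; rewrite cycle_subG.
  by rewrite orbF; case: eqVneq => // uv; rewrite -uv Cu in Cv.
move=> Gx Gy; rewrite power_graphE /local_adj /cell_code.
case: (boolP (x \in C)) => Cx; case: (boolP (y \in C)) => Cy /=.
- rewrite (inner x y) // (inner y x) //.
  case: eqVneq => [->|_] /=; last by rewrite oppr0 add0r.
  by rewrite dvdnn addNr.
- rewrite inner_outer //; case: eqVneq => [e|_]; first by rewrite -e Cx in Cy.
  by rewrite oppr0 add0r.
- rewrite eq_sym orbC inner_outer //.
  case: (eqVneq y x^-1%g) => [e|_]; last by rewrite andbF add0r.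
  by rewrite e groupV (negPf Cx) in Cy.
rewrite addr0 (cycle_outer_outer h_gt0 defG or s21 rel_sr Gx Cx Cy)
  (cycle_outer_outer h_gt0 defG or s21 rel_sr Gy Cy Cx).
case: eqVneq => //= _.
by rewrite [x == _]eq_sym (can2_eq invgK invgK) orbb.
Qed.

Local Notation index_code := (index_code (k := k) q).

(** The row sums of the local part on each cell: -1 on the cliques, 1 on the
    perfect matching, 0 on the independent set. *)
Definition cell_eigenvalue (c : bool * nat) : R :=
  if c.1 then - 1 else (c.2 == 4%N)%:R.

Definition cell_size (c : bool * nat) : nat := if c.1 then totient c.2 else h.

Let cell_code_index x : x \in G -> exists c, index_code c = cell_code x.
Proof.
move=> Gx; rewrite /cell_code; case: (boolP (x \in C)) => Cx; last first.
  case: (o24 Gx Cx) => ->.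
    by exists (rshift _ ord_max); rewrite index_codeE.
  by exists (rshift _ ord0); rewrite index_codeE.
have : (#[x]%g %| 2 ^ k * q)%N by rewrite -h_double -or order_dvdG.
by case/(dvdn_pow2q pq q2) => a [b [ak b1 ->]]; apply: index_code_innerP.
Qed.

Let card_cell c :
  #|[set x in G | cell_code x == index_code c]| = cell_size (index_code c).
Proof.
have [Oh Eh] := card_outer h_gt0 h_even defG or s21 rel_sr oG.
have := index_code_inner_dvd hk pq q2 (c := c); rewrite /cell_size.
case kc: (index_code c) => [[] d] /= => [/(_ isT) d_n|_].
  rewrite -(@card_cycle_order _ r) ?or ?h_double //.
  apply: eq_card => x; rewrite !inE xpair_eqE eqb_id.
  by case Cx: (x \in <[r]>%g); rewrite ?andbF //= (subsetP sCG).
have : d = 4%N \/ d = 2%N.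
  elim/index_caseP: c kc => i; rewrite index_codeE //.
  by case: eqP => _ [<-]; [left | right].
have setE m : #|[set x in G | cell_code x == (false, m)]| = #|outer G C m|.
  by apply: eq_card => x; rewrite !inE xpair_eqE eqbF_neg.
by rewrite setE; case=> ->.
Qed.

Let cell_mx : 'M[R]_(#|G|, 2 + 2 * k + 2) :=
  \matrix_(i, c) (cell_code (enum_val i) == index_code c)%:R.
Let cell_adj_mx : 'M[R]_(2 + 2 * k + 2, #|G|) :=
  \matrix_(c, i) (cell_adj (index_code c) (cell_code (enum_val i)))%:R.
Let eigenvalue_mx :=
  diag_mx (\row_(c < 2 + 2 * k + 2) cell_eigenvalue (index_code c)).

Let index_code_eq c c' : (index_code c == index_code c') = (c == c').
Proof. exact/inj_eq/index_code_inj. Qed.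

Lemma adjacency_mxE :
  adjacency_mx R G (@power_graph gT) = local_mx R G C + cell_mx *m cell_adj_mx.
Proof.
apply/matrixP=> i j; rewrite !mxE power_graph_local_cell ?enum_valP //.
congr (_ + _); have [c kc] := cell_code_index (enum_valP i).
rewrite (bigD1 c) // big1 => [|c' c'c]; rewrite !mxE -kc.
  by rewrite eqxx mul1r [RHS]addr0.
by rewrite index_code_eq eq_sym (negPf c'c) mul0r.
Qed.

(** Each row of the local part has at most one nonzero entry, at x or at x^-1,
    which lie in the same cell. *)
Lemma local_mx_cells : local_mx R G C *m cell_mx = cell_mx *m eigenvalue_mx.
Proof.
apply/matrixP=> i c; rewrite mul_mx_diag !mxE.
have := enum_valP i; set x := enum_val i => Gx.
transitivity
    (\sum_(y in G) local_adj R C x y * (cell_code y == index_code c)%:R).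
  by rewrite [RHS]big_enum_val /=; apply: eq_bigr => j _; rewrite !mxE.
have only y0 : y0 \in G -> cell_code y0 = cell_code x ->
    (forall y, y != y0 -> local_adj R C x y = 0) ->
    \sum_(y in G) local_adj R C x y * (cell_code y == index_code c)%:R
      = (cell_code x == index_code c)%:R * local_adj R C x y0.
  move=> Gy0 <- adj0; rewrite (bigD1 y0) //= big1 ?addr0 1?mulrC // => y.
  by case/andP=> _ /adj0->; apply: mul0r.
have [Cx|Cx] := boolP (x \in C).
  rewrite (only x) // => [|y]; rewrite /local_adj Cx; last first.
    by rewrite eq_sym => /negPf->; rewrite oppr0.
  by case: eqP => [<-|_]; rewrite ?mul0r // /cell_eigenvalue /= Cx eqxx.
rewrite (only x^-1%g) ?groupV // => [||y]; last 2 first.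
- by rewrite /cell_code groupV orderV.
- by rewrite /local_adj (negPf Cx) => /negPf->; rewrite andbF.
case: eqP => [<-|_]; last by rewrite !mul0r.
rewrite /cell_eigenvalue /local_adj (negPf Cx) /= eqxx andbT (negPf Cx).
rewrite eq_sym eq_invg_mul -expg2 -order_dvdn.
by case: (o24 Gx Cx) => ->.
Qed.

(** The entry at (c, c') of the product of the cell matrices is the size of c'
    if the two cells are adjacent, else 0; sizes are totients inside <r> and h
    outside.  The nine cases are the nine blocks of the quotient matrix. *)
Lemma Qmx_cells : Qmx R k q = eigenvalue_mx + cell_adj_mx *m cell_mx.
Proof.
have WU c c' : (cell_adj_mx *m cell_mx) c c'
    = (cell_adj (index_code c) (index_code c') * cell_size (index_code c'))%:R.
  rewrite -card_cell natrM -sum_bool_card mulr_sumr [RHS]big_enum_val mxE.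
  by apply: eq_bigr => i _; rewrite !mxE; case: eqP => [->|_]; rewrite ?mulr0.
have LE c c' : eigenvalue_mx c c' = cell_eigenvalue (index_code c) *+ (c == c').
  by rewrite !mxE.
have dQ_ndvd d j : (d <= 2)%N -> (0 < d)%N -> (dQ k q j %| d)%N = false.
  move=> d2 d0; apply/negP => /(dvdn_leq d0).
  by rewrite leqNgt (leq_ltn_trans d2) // dQ_gt2.
apply/matrixP=> c c'; rewrite [RHS]mxE WU LE /Qmx.
elim/index_caseP: c => i; elim/index_caseP: c' => j; rewrite !index_codeE;
  rewrite /cell_eigenvalue /cell_size /cell_adj /=.
- rewrite !block_mxEul !(inj_eq (@lshift_inj _ _)) mxE.
  by case: i j => [[|[|]] //= ?] [[|[|]] //= ?]; rewrite ?addNr ?add0r.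
- rewrite block_mxEul block_mxEur (inj_eq (@lshift_inj _ _)) eq_lrshift add0r.
  rewrite mxE.
  case: i => [[|[|]] //= ?]; rewrite ?dvd1n ?mul1n //.
  rewrite dQ_even // dQ_ndvd // orbF; by case: eqP; rewrite ?mul1n.
- rewrite block_mxEur eq_lrshift add0r col_mxEu mxE.
  by case: i j => [[|[|]] //= ?] [[|[|]] //= ?]; rewrite ?mul1n ?mul0n.
- rewrite block_mxEul block_mxEdl (inj_eq (@lshift_inj _ _)) eq_rlshift add0r.
  rewrite !mxE.
  case: j => [[|[|]] //= ?]; rewrite ?dvd1n ?orbT ?muln1 //.
  rewrite dQ_even // dQ_ndvd //=; by case: eqP; rewrite ?mul1n.
- rewrite block_mxEul block_mxEdr (inj_eq (@lshift_inj _ _)).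
  rewrite (inj_eq (@rshift_inj _ _)) mxE.
  case: eqVneq => [<-|_]; first by rewrite dvdnn mul1n addrC.
  by rewrite add0r; case: ifP => _; rewrite ?mul1n.
- rewrite block_mxEur eq_lrshift add0r col_mxEd mxE dQ_ndvd ?mul0n //;
  by case: (nat_of_ord j).
- rewrite block_mxEdl eq_rlshift add0r row_mxEl mxE.
  by case: i j => [[|[|]] //= ?] [[|[|]] //= ?]; rewrite ?mul1n ?mul0n.
- rewrite block_mxEdl eq_rlshift add0r row_mxEr mxE dQ_ndvd ?mul0n //;
  by case: (nat_of_ord i).
rewrite block_mxEdr mul0n addr0 (inj_eq (@rshift_inj _ _)) mxE.
by case: i j => [[|[|]] //= ?] [[|[|]] //= ?].
Qed.

Lemma char_poly_eigenvalue_mx :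
  char_poly eigenvalue_mx = ('X + 1) ^+ (2 + 2 * k) * ('X - 1) * 'X.
Proof.
rewrite char_poly_diag big_split_ord /= -mulrA; congr (_ * _).
  rewrite (eq_bigr (fun=> 'X + 1)) ?prodr_const ?card_ord // => c _.
  rewrite mxE /cell_eigenvalue.
  suff -> : (index_code (lshift 2 c)).1 by rewrite polyCN opprK.
  by case: (split_ordP c) => i ->; rewrite index_codeE.
rewrite !big_ord_recl big_ord0 mulr1 !mxE !index_codeE /cell_eigenvalue /=.
by rewrite subr0.
Qed.

(** With p = 2^(k-2) q, the local part contributes
    (X + 1)^(5p) X^(2p) (X - 1)^p, and the cells account for one factor each:
    2k + 2 factors X + 1, one factor X - 1 and one factor X, all of which are
    cancelled. *)
Lemma char_poly_power_graph :
  char_poly (adjacency_mx R G (@power_graph gT)) =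
    'X ^+ (2 ^ (k - 1) * q - 1)
    * ('X - 1) ^+ (2 ^ (k - 2) * q - 1)
    * ('X + 1) ^+ (5 * 2 ^ (k - 2) * q - 2 * k - 2)
    * char_poly (Qmx R k q).
Proof.
have [Oh Eh] := card_outer h_gt0 h_even defG or s21 rel_sr oG.
set p := (2 ^ (k - 2) * q)%N.
have hp : h = (2 * p)%N.
  by rewrite /h /p mulnA -expnS -subSn //= subSS.
have p_gt0 : (0 < p)%N by rewrite muln_gt0 expn_gt0 (prime_gt0 pq).
(* This makes the truncated subtraction in the exponent of X + 1 exact. *)
have kp : (2 * k + 2 <= 5 * p)%N.
  have q_gt2 : (2 < q)%N by rewrite ltn_neqAle eq_sym q2 prime_gt1.
  have k2 : (k < 2 ^ k)%N by apply: ltn_expl.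
  have : (3 * 2 ^ k <= 2 * h)%N.
    by rewrite mul2n h_double mulnC leq_mul2l q_gt2 orbT.
  by rewrite hp; lia.
have Op : #|outer G C 4| = (2 * p)%N by rewrite -hp.
have Ep : #|outer G C 2| = (2 * p)%N by rewrite -hp.
have Cp : #|C| = (4 * p)%N by rewrite [LHS]or hp; lia.
have := char_poly_intertwine cell_adj_mx local_mx_cells.
rewrite -adjacency_mxE -Qmx_cells char_poly_eigenvalue_mx.
rewrite (char_poly_local_mx R sCG o24 Op) Cp Ep => charA.
have regL : GRing.rreg (('X + 1 : {poly R}) ^+ (2 + 2 * k) * ('X - 1) * 'X).
  have mX1 : ('X + 1 : {poly R}) \is monic by rewrite -polyC1 monicXaddC.
  have mX2 : ('X - 1 : {poly R}) \is monic by rewrite -polyC1 monicXsubC.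
  by apply/monic_rreg/rpredM/monicX/rpredM/mX2/rpredX/mX1.
apply: regL; rewrite {}charA.
have -> : (4 * p + p = (5 * 2 ^ (k - 2) * q - 2 * k - 2) + (2 + 2 * k))%N.
  by rewrite -mulnA -/p; lia.
have -> : (2 ^ (k - 1) * q - 1 = (2 * p).-1)%N by rewrite -hp subn1.
have exprK (a : {poly R}) n : (0 < n)%N -> a ^+ n = a * a ^+ n.-1.
  by move=> n_gt0; rewrite -exprS prednK.
have p2_gt0 : (0 < 2 * p)%N by rewrite muln_gt0.
rewrite (exprK 'X (2 * p)%N) // (exprK ('X - 1) p) // subn1 exprD.
ring.
Qed.

End Cells.

Local Open Scope ring_scope.

Theorem theorem4p1 (R : numDomainType) (k q : nat)
    (gT : finGroupType) (G : {group gT})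
    (hk : (2 <= k)%N) (hq : prime q) (hq2 : q <> 2%N)
    (hG : (G \isog Grp (r : s : s ^+ 2 = r ^+ (2 ^ k * q)%N = 1,
                                s * r * s^-1 = r ^+ (2 ^ (k - 1) * q - 1)%N))%g) :
  char_poly (adjacency_mx R G (@power_graph gT)) =
    'X ^+ (2 ^ (k - 1) * q - 1)
    * ('X - 1) ^+ (2 ^ (k - 2) * q - 1)
    * ('X + 1) ^+ (5 * 2 ^ (k - 2) * q - 2 * k - 2)
    * char_poly (Qmx R k q).
Proof.
have h_double := half_order_double q hk.
have h_gt0 := half_order_gt0 k hq.
have ee1 := sqr_pred_mod_double h_gt0 (half_order_even q hk).
rewrite h_double in ee1.
have n_gt1 : (1 < 2 ^ k * q)%N by lia.
have [r [s [defG or s21 rel_sr oG]]] := isoGrp_order2_extension n_gt1 ee1 hG.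
rewrite -h_double in or oG.
by apply: (char_poly_power_graph R hk hq _ defG); first exact/eqP.
Qed.
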